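(* Fix $H$ and $\Lambda$. (1) There is a family $\{G_d\}_{d=1}^\infty$ with each $G_d$ a $d$-regular bipartite graph, a function $g(d)$ with $g(d)=o(1)$ as $d\to\infty$, and a positive constant $c$ (depending on $H$ and $\Lambda$) such that for every $d$ and every $k \in V(H)$, with $f$ chosen from ${\rm Hom}(G_d,H)$ according to $p_\Lambda$, $$p_\Lambda\left( \left|s(k,f)-a_\Lambda^+(k)\right| \leq g(d) \right)\geq c-g(d) \quad\text{and}\quad p_\Lambda\left( \left|s(k,f)-a_\Lambda^-(k)\right| \leq g(d) \right)\geq c-g(d).$$ (2) There is a family $\{G'_d\}_{d=1}^\infty$ with each $G'_d$ a $d$-regular bipartite graph, a function $g(d)$ with $g(d) = o(1)$ as $d\to\infty$, and, for each $k \in V(H)$, a number $a_\Lambda(k)$ satisfying $a^-_\Lambda(k) \leq a_\Lambda(k) \leq a^+_\Lambda(k)$, such that for every $d$ and every $k\in V(H)$, with $f$ chosen from ${\rm Hom}(G'_d,H)$ according to $p_\Lambda$, $$p_\Lambda\left( \left|s(k,f)-a_\Lambda(k)\right| \leq g(d) \right) \geq 1-g(d)\quad\text{and}\quad |\bar{p}_\Lambda(k) - a_\Lambda(k)| \leq g(d).$$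
   Context: All graphs $G$ (in particular $G_d$, $G'_d$) are simple, loopless and finite; $H$ is a finite graph without multiple edges but perhaps with loops, having at least one edge (possibly a loop); $\Lambda=\{\lambda_i : i\in V(H)\}$ is a set of positive real weights indexed by the vertices of $H$. An $H$-colouring of $G$ is a function $f:V(G)\to V(H)$ such that $uv\in E(G)$ implies $f(u)f(v)\in E(H)$; ${\rm Hom}(G,H)$ is the set of these. Put $w_\Lambda(f)=\prod_{v\in V(G)}\lambda_{f(v)}$, $Z_\Lambda(G,H)=\sum_{f\in{\rm Hom}(G,H)}w_\Lambda(f)$, and let $p_\Lambda$ be the probability distribution on ${\rm Hom}(G,H)$ with $p_\Lambda(f)=w_\Lambda(f)/Z_\Lambda(G,H)$. For $f \in {\rm Hom}(G,H)$ and $k\in V(H)$ let $s(k,f)=|f^{-1}(k)|/|V(G)|$ and let $\bar p_\Lambda(k)=\frac{1}{|V(G)|}\sum_{v\in V(G)}p_\Lambda(f(v)=k)$, the expectation of $s(k,f)$ under $p_\Lambda$. For $A,B\subseteq V(H)$ write $A\sim B$ if $uv\in E(H)$ for all $u\in A$, $v\in B$. Let $w_\Lambda(A)=\sum_{i\in A}\lambda_i$, $\eta_\Lambda(H)=\max\{w_\Lambda(A)w_\Lambda(B):A\sim B\}$, and $\mathcal{M}_\Lambda(H)=\{(A,B): A,B\subseteq V(H),\ A\sim B,\ w_\Lambda(A)w_\Lambda(B)=\eta_\Lambda(H)\}$. For $k\in V(H)$ let $$a_\Lambda^+(k)=\frac{\max\{w_\Lambda(A)\lambda_k\mathbf{1}_{\{k\in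 B\}}+w_\Lambda(B)\lambda_k\mathbf{1}_{\{k\in A\}}:(A,B)\in\mathcal{M}_\Lambda(H)\}}{2\eta_\Lambda(H)},$$ and let $a_\Lambda^-(k)$ be defined in the same way with $\max$ replaced by $\min$. *)

(* Defs.v *)
From HB Require Import structures.
From mathcomp Require Import all_boot all_order all_algebra.

Set Implicit Arguments.
Unset Strict Implicit.
Unset Printing Implicit Defensive.

Import Order.TTheory GRing.Theory Num.Theory.
Local Open Scope ring_scope.

(* Finite graphs without multiple edges; loops are allowed. *)
Record graph := Graph {
  vertex :> finType;
  edge : rel vertex;
  edge_sym : symmetric edge }.

Definition loopless (G : graph) : Prop := irreflexive (@edge G).

Definition regular (d : nat) (G : graph) : Prop :=
  forall v : G, #|[set u | edge v u]| = d.

Definition bipartite (G : graph) : Prop :=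
  exists X : {set G}, forall u v : G, edge u v -> (u \in X) != (v \in X).

(* The empty graph is excluded, since proportions of the vertex set
   of G are considered. *)
Definition regular_bipartite (d : nat) (G : graph) : Prop :=
  [/\ (0 < #|G|)%N, loopless G, regular d G & bipartite G].

(* Largest and smallest entry of a nonempty sequence (0 on [::]). *)
Definition seq_max (R : realFieldType) (s : seq R) : R :=
  \big[Num.max/head 0 s]_(x <- s) x.

Definition seq_min (R : realFieldType) (s : seq R) : R :=
  \big[Num.min/head 0 s]_(x <- s) x.

Section Colourings.
Variables (R : realFieldType) (H : graph) (lam : H -> R).

Section Source.
Variable G : graph.

Definition Hcolourings : {set {ffun G -> H}} :=
  [set f : {ffun G -> H} |
    [forall u : G, forall v : G, edge u v ==> edge (f u) (f v)]].

Definition weight (f : {ffun G -> H}) : R := \prod_(v : G) lam (f v).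

Definition Zsum : R := \sum_(f in Hcolourings) weight f.

Definition pmf (f : {ffun G -> H}) : R := weight f / Zsum.

Definition prob (E : pred {ffun G -> H}) : R := \sum_(f in Hcolourings | E f) pmf f.

Definition prop_col (k : H) (f : {ffun G -> H}) : R :=
  #|[set v | f v == k]|%:R / #|G|%:R.

Definition pbar (k : H) : R :=
  (\sum_(v : G) prob (fun f => f v == k)) / #|G|%:R.

End Source.

Definition complete_to (A B : {set H}) : bool :=
  [forall u in A, forall v in B, edge u v].

Definition wset (A : {set H}) : R := \sum_(i in A) lam i.

Definition eta : R :=
  seq_max [seq wset AB.1 * wset AB.2
          | AB in [set AB | complete_to AB.1 AB.2]].

Definition maxpairs : {set {set H} * {set H}} :=
  [set AB | complete_to AB.1 AB.2 & wset AB.1 * wset AB.2 == eta].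

Definition pair_value (k : H) (AB : {set H} * {set H}) : R :=
  wset AB.1 * lam k * (k \in AB.2)%:R + wset AB.2 * lam k * (k \in AB.1)%:R.

Definition aplus (k : H) : R :=
  seq_max [seq pair_value k AB | AB in maxpairs] / (2 * eta).

Definition aminus (k : H) : R :=
  seq_min [seq pair_value k AB | AB in maxpairs] / (2 * eta).

End Colourings.

(* Main.v *)
Require Import Defs.
From HB Require Import structures.
From mathcomp Require Import all_boot all_order all_algebra.
From mathcomp Require Import all_classical all_reals all_analysis.
From mathcomp Require Import finset ring lra.

(** Both families are built from the complete bipartite graph K_{d,d}.

    An H-colouring of K_{d,d} uses a set A of colours on one side and a set B
    on the other with A ~ B, and conversely, if A ~ B, the two sides may be
    coloured freely from A and from B.  So the colourings are covered by boxes,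
    one for each complete pair (A, B); the box of (A, B) has total weight
    (w(A) w(B))^d, and under the weight restricted to a box the colours of the
    2d vertices are independent.  Hence inside a box the proportion of colour k
    has variance O(1/d) ([box_second_moment]) around
      (lambda_k 1_{k in A} / w(A) + lambda_k 1_{k in B} / w(B)) / 2,
    called [pair_prop] below; for a pair attaining eta it is the quantity whose
    maximum and minimum define a^+ and a^-.

    For the first family take G_d = K_{d,d}.  As Z is at most the number of
    pairs times eta^d, the box of each maximal pair carries a probability
    bounded below by a constant, and Chebyshev's inequality in the box of a
    pair attaining a^+(k) or a^-(k) concludes ([prob_near_pair]).

    For the second family, two distinct maximal boxes meet in the box of the
    intersected pair, which is not maximal since the weights are positive.  So
    up to non-maximal boxes, whose weight relative to eta^d is exponentially
    small, the colouring measure is the sum of the maximal box measures, and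
    these all have the same mass.  The mean proportion of colour k in K_{d,d}
    therefore tends to a(k), the average of [pair_prop] over the maximal pairs
    ([pbar_complete_bipartite]).  Passing to d + 1 disjoint copies of K_{d,d}
    preserves the mean and divides the variance by the number of copies, which
    gives concentration at a(k) ([prob_near_copies]). *)

Set Implicit Arguments.
Unset Strict Implicit.
Unset Printing Implicit Defensive.

Import Order.TTheory GRing.Theory Num.Theory.
Import numFieldNormedType.Exports.
Local Open Scope ring_scope.

(** * Moments under a product of weights *)

Section ProductWeights.
Variables (R : realFieldType) (I T : finType) (mu : I -> T -> R).

Lemma sum_prod_weight (c : I -> T -> R) :
  \sum_(F : {ffun I -> T}) (\prod_i mu i (F i)) * (\prod_i c i (F i))
  = \prod_i \sum_t mu i t * c i t.
Proof.
by rewrite bigA_distr_bigA; apply: eq_bigr => F _; rewrite big_split.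
Qed.

Lemma prod_single (i : I) (x : I -> R) :
  \prod_j (if j == i then x j else 1) = x i.
Proof. by rewrite -big_mkcond big_pred1_eq. Qed.

Variable phi : I -> T -> R.
Hypothesis phi_centred : forall i, \sum_t mu i t * phi i t = 0.

Lemma first_moment_centred :
  \sum_(F : {ffun I -> T}) (\prod_i mu i (F i)) * (\sum_i phi i (F i)) = 0.
Proof.
under eq_bigr => F _ do rewrite mulr_sumr.
rewrite exchange_big big1 // => i _ /=.
transitivity (\sum_(F : {ffun I -> T}) (\prod_j mu j (F j)) *
    \prod_j (if j == i then phi j (F j) else 1)).
  by apply: eq_bigr => F _; rewrite prod_single.
rewrite (sum_prod_weight (fun j t => if j == i then phi j t else 1)).
by apply/eqP; rewrite prodf_seq_eq0; apply/hasP; exists i;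
  rewrite ?mem_index_enum //= eqxx phi_centred.
Qed.

(** The coordinates are independent, so a product of centred functions of two
    different coordinates has a vanishing factor. *)
Lemma cross_moment_centred (i j : I) : i != j ->
  \sum_(F : {ffun I -> T})
    (\prod_l mu l (F l)) * (phi i (F i) * phi j (F j)) = 0.
Proof.
move=> neq_ij.
pose c l t := (if l == i then phi l t else 1) * (if l == j then phi l t else 1).
transitivity (\sum_(F : {ffun I -> T}) (\prod_l mu l (F l)) *
    \prod_l c l (F l)).
  by apply: eq_bigr => F _; rewrite big_split /= !prod_single.
rewrite (sum_prod_weight c).
apply/eqP; rewrite prodf_seq_eq0; apply/hasP; exists i;
  rewrite ?mem_index_enum //= /c eqxx (negPf neq_ij).
by under eq_bigr => t _ do rewrite mulr1; rewrite phi_centred.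
Qed.

(** Only the diagonal terms of the squared sum survive; this is additivity of
    the variance, for weights that need not have total mass 1. *)
Lemma second_moment_centred :
  (forall i t, 0 <= mu i t) -> (forall i t, `|phi i t| <= 1) ->
  \sum_(F : {ffun I -> T}) (\prod_i mu i (F i)) * (\sum_i phi i (F i)) ^+ 2
  <= #|I|%:R * \prod_i \sum_t mu i t.
Proof.
move=> mu_ge0 phi_le1.
have square_expand (F : {ffun I -> T}) :
    (\prod_i mu i (F i)) * (\sum_i phi i (F i)) ^+ 2 =
    \sum_i \sum_j (\prod_l mu l (F l)) * (phi i (F i) * phi j (F j)).
  rewrite expr2 mulr_suml mulr_sumr; apply: eq_bigr => i _.
  by rewrite !mulr_sumr.
rewrite (eq_bigr _ (fun F _ => square_expand F)).
rewrite exchange_big /= mulr_natl -sumr_const.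
apply: ler_sum => i _; rewrite exchange_big /= (bigD1 i) //=.
rewrite [X in _ + X]big1 => [|j neq_ji]; last first.
  by rewrite cross_moment_centred // eq_sym.
rewrite addr0 bigA_distr_bigA; apply: ler_sum => F _.
apply: ler_piMr; first by apply: prodr_ge0 => j _.
by rewrite -expr2 -real_normK ?num_real // expr_le1.
Qed.

End ProductWeights.

(** Chebyshev's inequality bounds the mass outside by g^3 / g^2 = g of the
    total: a cubic bound on the second moment lets the same g measure both the
    deviation and the lost probability. *)
Lemma chebyshev_cubic (R : realFieldType) (T : finType) (W X : T -> R)
    (a g : R) :
  (forall t, 0 <= W t) -> 0 < g ->
  \sum_t W t * (X t - a) ^+ 2 <= g ^+ 3 * \sum_t W t ->
  (1 - g) * \sum_t W t <= \sum_(t | `|X t - a| <= g) W t.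
Proof.
move=> W_ge0 g_gt0 var_le.
pose near := fun t => `|X t - a| <= g.
have far_le : g ^+ 2 * (\sum_(t | ~~ near t) W t) <= g ^+ 2 * (g * \sum_t W t).
  rewrite mulrA -exprSr; apply: le_trans var_le.
  rewrite [leRHS](bigID near) /= mulr_sumr ler_wpDl //.
    by apply: sumr_ge0 => t _; rewrite mulr_ge0 ?sqr_ge0.
  apply: ler_sum => t; rewrite /near -ltNge => far.
  rewrite mulrC ler_wpM2l // -[leRHS]real_normK ?num_real //.
  by rewrite lerXn2r ?nnegrE // ltW.
move: far_le; rewrite ler_pM2l ?exprn_gt0 // mulrBl mul1r lerBlDr => far_le.
by rewrite [leLHS](bigID near) /= lerD2l.
Qed.

(** * Extrema of a sequence *)

Section SeqExtrema.
Variable R : realFieldType.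

Lemma seq_max_mem (s : seq R) : s != [::] -> seq_max s \in s.
Proof.
move=> s_neq0; rewrite /seq_max big_seq.
apply: (big_ind (fun m => m \in s)) => // [|x y xs ys]; last by case: leP.
by case: s s_neq0 => // x s _; rewrite mem_head.
Qed.

Lemma seq_min_mem (s : seq R) : s != [::] -> seq_min s \in s.
Proof.
move=> s_neq0; rewrite /seq_min big_seq.
apply: (big_ind (fun m => m \in s)) => // [|x y xs ys]; last by case: leP.
by case: s s_neq0 => // x s _; rewrite mem_head.
Qed.

Lemma le_seq_max (s : seq R) x : x \in s -> x <= seq_max s.
Proof. by move=> xs; exact: (@le_bigmax_seq _ _ _ _ _ _ xpredT id). Qed.

Lemma seq_min_le (s : seq R) x : x \in s -> seq_min s <= x.
Proof. by move=> xs; exact: (@ge_bigmin_seq _ _ _ _ _ _ xpredT id). Qed.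

End SeqExtrema.

(** * Regular bipartite graphs *)

Fact neq_side_sym d : symmetric (fun u v : bool * 'I_d => u.1 != v.1).
Proof. by move=> u v; rewrite eq_sym. Qed.

Definition complete_bipartite d : graph := Graph (@neq_side_sym d).

Fact copies_edge_sym n (G : graph) :
  symmetric (fun u v : 'I_n * G => (u.1 == v.1) && edge u.2 v.2).
Proof. by move=> u v; rewrite eq_sym edge_sym. Qed.

Definition copies n (G : graph) : graph := Graph (@copies_edge_sym n G).

Lemma card_complete_bipartite d : #|complete_bipartite d| = (2 * d)%N.
Proof. by rewrite card_prod card_bool card_ord. Qed.

Lemma card_copies n G : #|copies n G| = (n * #|G|)%N.
Proof. by rewrite card_prod card_ord. Qed.

Lemma complete_bipartite_regular d :
  (0 < d)%N -> regular_bipartite d (complete_bipartite d).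
Proof.
move=> d_gt0; split.
- by rewrite card_complete_bipartite muln_gt0.
- by move=> v; rewrite /edge /= eqxx.
- move=> [b i]; rewrite -[RHS]mul1n -[X in (X * _)%N](cards1 (~~ b)).
  rewrite -[X in (_ * X)%N](card_ord d) -cardsT -cardsX.
  apply: eq_card => -[b' j]; rewrite !inE /edge /= andbT.
  by case: b b' => -[].
- exists [set v | v.1] => u v; rewrite /edge /= !inE.
  by case: u v => [] [] ? [] [].
Qed.

Lemma copies_regular d n G : (0 < n)%N ->
  regular_bipartite d G -> regular_bipartite d (copies n G).
Proof.
move=> n_gt0 [G_gt0 G_loop G_reg [X G_bip]]; split.
- by rewrite card_copies muln_gt0 n_gt0.
- by move=> [i v]; rewrite /edge /= G_loop andbF.
- move=> [i v]; rewrite -(G_reg v) -[RHS]mul1n -[X in (X * _)%N](cards1 i).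
  rewrite -cardsX; apply: eq_card => -[j u].
  by rewrite !inE /edge /= eq_sym.
- by exists [set v | v.2 \in X] => u v /andP[_ /G_bip]; rewrite !inE.
Qed.

(** * Colouring weights as weights on all functions *)

Section HomWeights.
Variables (R : realFieldType) (H : graph) (lam : H -> R).
Hypothesis lam_gt0 : forall i : H, 0 < lam i.

(** Extending the weight by zero outside the colourings turns every sum into
    one over all functions, where product structures are visible. *)
Definition hom_weight (G : graph) (f : {ffun G -> H}) : R :=
  weight lam f * (f \in Hcolourings H G)%:R.

Lemma weight_gt0 (G : graph) (f : {ffun G -> H}) : 0 < weight lam f.
Proof. by apply: prodr_gt0. Qed.

Lemma hom_weight_ge0 (G : graph) (f : {ffun G -> H}) : 0 <= hom_weight f.
Proof. by rewrite mulr_ge0 ?ler0n // ltW // weight_gt0. Qed.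

Lemma hom_weight_sum (G : graph) (P : pred {ffun G -> H})
    (X : {ffun G -> H} -> R) :
  \sum_(f in Hcolourings H G | P f) weight lam f * X f =
  \sum_(f | P f) hom_weight f * X f.
Proof.
rewrite big_mkcondl; apply: eq_bigr => f _; rewrite /hom_weight.
by case: (f \in _); rewrite ?mulr1 // mulr0 mul0r.
Qed.

Lemma Zsum_hom_weight (G : graph) :
  Zsum lam G = \sum_(f : {ffun G -> H}) hom_weight f.
Proof.
transitivity (\sum_(f in Hcolourings H G | true) weight lam f * 1).
  by apply: eq_big => [f|f _]; rewrite ?andbT ?mulr1.
by rewrite hom_weight_sum; apply: eq_bigr => f _; rewrite mulr1.
Qed.

Lemma prob_hom_weight (G : graph) (E : pred {ffun G -> H}) :
  prob lam E = (\sum_(f | E f) hom_weight f) / Zsum lam G.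
Proof.
by rewrite /prob /pmf hom_weight_sum mulr_suml.
Qed.

Lemma prob_ge0 (G : graph) (E : pred {ffun G -> H}) : 0 <= prob lam E.
Proof.
rewrite prob_hom_weight Zsum_hom_weight divr_ge0 //;
  by apply: sumr_ge0 => f _; exact: hom_weight_ge0.
Qed.

Lemma prop_col_mean (G : graph) k (f : {ffun G -> H}) :
  prop_col R k f = (\sum_v (f v == k)%:R) / #|G|%:R.
Proof.
rewrite /prop_col; congr (_ / _); rewrite -sum1_card natr_sum big_mkcond /=.
by apply: eq_bigr => v _; rewrite inE; case: (f v == k).
Qed.

Lemma prop_col_ge0 (G : graph) k (f : {ffun G -> H}) : 0 <= prop_col R k f.
Proof. by rewrite divr_ge0 ?ler0n. Qed.

Lemma prop_col_le1 (G : graph) k (f : {ffun G -> H}) : prop_col R k f <= 1.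
Proof.
rewrite /prop_col; have [->|G_gt0] := posnP #|G|.
  by rewrite invr0 mulr0 ler01.
by rewrite ler_pdivrMr ?ltr0n // mul1r ler_nat max_card.
Qed.

Lemma pbar_hom_weight (G : graph) k :
  pbar lam G k =
  (\sum_(f : {ffun G -> H}) hom_weight f * prop_col R k f) / Zsum lam G.
Proof.
rewrite /pbar; under eq_bigr => v _ do rewrite prob_hom_weight.
rewrite -mulr_suml mulrAC; congr (_ / _).
under [RHS]eq_bigr => f _ do rewrite prop_col_mean mulrA mulr_sumr.
rewrite -mulr_suml; congr (_ / _); rewrite exchange_big /=.
apply: eq_bigr => v _; rewrite big_mkcond; apply: eq_bigr => f _.
by case: (f v == k); rewrite ?mulr1 ?mulr0.
Qed.

Lemma pbar_itv (G : graph) k :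
  0 < Zsum lam G -> 0 <= pbar lam G k <= 1.
Proof.
move=> Z_gt0; rewrite pbar_hom_weight; apply/andP; split.
  rewrite divr_ge0 ?(ltW Z_gt0) // sumr_ge0 // => f _.
  by rewrite mulr_ge0 ?prop_col_ge0 ?hom_weight_ge0.
rewrite ler_pdivrMr // mul1r Zsum_hom_weight; apply: ler_sum => f _.
by rewrite ler_piMr ?prop_col_le1 ?hom_weight_ge0.
Qed.

End HomWeights.

(** * Independent colourings of the two sides of a complete bipartite graph *)

Section CompleteBipartite.
Variables (R : realFieldType) (H : graph) (lam : H -> R).
Hypothesis lam_gt0 : forall i : H, 0 < lam i.
Implicit Types P Q : {set H} * {set H}.

Definition side P (b : bool) : {set H} := if b then P.2 else P.1.

Definition pair_weight P : R := wset lam P.1 * wset lam P.2.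

(** The mean proportion of colour [k] when the vertices of the two sides choose
    their colours independently, from [P.1] and [P.2], with probabilities
    proportional to the weights; see [pair_prop_sides]. *)
Definition pair_prop (k : H) P : R :=
  pair_value lam k P / (2 * pair_weight P).

Lemma wset_ge0 (A : {set H}) : 0 <= wset lam A.
Proof. by apply: sumr_ge0 => i _; exact: ltW. Qed.

Lemma pair_weight_ge0 P : 0 <= pair_weight P.
Proof. by rewrite mulr_ge0 ?wset_ge0. Qed.

Lemma wset_side_gt0 P b : 0 < pair_weight P -> 0 < wset lam (side P b).
Proof.
rewrite /pair_weight lt_def mulf_eq0 negb_or.
by case/andP=> /andP[? ?] _; case: b; rewrite lt_def wset_ge0 andbT.
Qed.

(** The law, under the box of [P], of the colour of a vertex of side [b]. *)
Definition side_prop k P b : R :=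
  lam k * (k \in side P b)%:R / wset lam (side P b).

Lemma pair_prop_sides k P : 0 < pair_weight P ->
  pair_prop k P = (side_prop k P false + side_prop k P true) / 2.
Proof.
move=> P_gt0; have := wset_side_gt0 false P_gt0.
have := wset_side_gt0 true P_gt0; rewrite /pair_prop /pair_value /side_prop /=.
move=> wB wA; rewrite /pair_weight.
by field; rewrite !gt_eqF.
Qed.

Lemma side_prop_ge0 k P b : 0 <= side_prop k P b.
Proof. by rewrite divr_ge0 ?wset_ge0 // mulr_ge0 ?ler0n // ltW. Qed.

Lemma side_prop_le1 k P b : 0 < pair_weight P -> side_prop k P b <= 1.
Proof.
move=> P_gt0; rewrite /side_prop ler_pdivrMr ?wset_side_gt0 // mul1r.
have [kP|_] := boolP (k \in side P b); last by rewrite mulr0 wset_ge0.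
rewrite mulr1 /wset (bigD1 k) //= lerDl; apply: sumr_ge0 => i _.
exact: ltW.
Qed.

Lemma pair_prop_itv k P : 0 < pair_weight P -> 0 <= pair_prop k P <= 1.
Proof.
move=> P_gt0; rewrite pair_prop_sides //.
have := side_prop_le1 k true P_gt0; have := side_prop_le1 k false P_gt0.
have := side_prop_ge0 k P true; have := side_prop_ge0 k P false.
by move=> *; apply/andP; split; lra.
Qed.

Section FixedDegree.
Variable d : nat.
Local Notation K := (complete_bipartite d).
Implicit Type f : {ffun K -> H}.

Definition within P f : bool := [forall v, f v \in side P v.1].

(** The restriction of the weight to the box of [P], written as a product over
    the vertices: under it their colours are independent. *)
Definition box_weight P f : R :=
  \prod_v (lam (f v) * (f v \in side P v.1)%:R).

Lemma box_weight_within P f : box_weight P f = weight lam f * (within P f)%:R.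
Proof.
rewrite /box_weight big_split /=; congr (_ * _).
case: (boolP (within P f)) => [/forallP f_in|/forallPn[v f_out]].
  by rewrite big1 // => v _; rewrite f_in.
by rewrite (bigD1 v) //= (negPf f_out) mul0r.
Qed.

Lemma box_weight_ge0 P f : 0 <= box_weight P f.
Proof. by apply: prodr_ge0 => v _; rewrite mulr_ge0 ?ler0n // ltW. Qed.

Lemma prod_sides (x : bool -> R) :
  \prod_(v : K) x v.1 = (x false * x true) ^+ d.
Proof.
transitivity (\prod_(b : bool) \prod_(i < d) x b); last first.
  by rewrite big_bool !prodr_const card_ord exprMn mulrC.
by rewrite pair_bigA.
Qed.

Lemma sum_sides (x : bool -> R) :
  \sum_(v : K) x v.1 = d%:R * (x false + x true).
Proof.
transitivity (\sum_(b : bool) \sum_(i < d) x b); last first.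
  by rewrite big_bool !sumr_const card_ord addrC mulrDr !mulr_natl.
by rewrite pair_bigA.
Qed.

Lemma sum_side_weight P b :
  \sum_h lam h * (h \in side P b)%:R = wset lam (side P b).
Proof.
rewrite /wset [RHS]big_mkcond; apply: eq_bigr => h _.
by case: (h \in _); rewrite ?mulr1 ?mulr0.
Qed.

Lemma prod_side_weight P :
  \prod_(v : K) \sum_h lam h * (h \in side P v.1)%:R = pair_weight P ^+ d.
Proof.
rewrite -(prod_sides (fun b => wset lam (side P b))).
by apply: eq_bigr => v _; rewrite sum_side_weight.
Qed.

Lemma sum_box_weight P : \sum_f box_weight P f = pair_weight P ^+ d.
Proof. by rewrite -prod_side_weight bigA_distr_bigA. Qed.

Section Moments.
Variables (k : H) (P : {set H} * {set H}).
Hypotheses (d_gt0 : (0 < d)%N) (P_gt0 : 0 < pair_weight P).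

Let dev (v : K) (h : H) : R := (h == k)%:R - side_prop k P v.1.

Let dev_centred v :
  \sum_h lam h * (h \in side P v.1)%:R * dev v h = 0.
Proof.
under eq_bigr => h _ do rewrite mulrBr.
rewrite sumrB -mulr_suml sum_side_weight (bigD1 k) //= eqxx mulr1.
rewrite big1 => [|h /negPf->]; last by rewrite mulr0.
rewrite addr0 /side_prop [X in _ - X]mulrC divfK ?subrr // gt_eqF //.
exact: wset_side_gt0.
Qed.

Let sum_dev f :
  \sum_v dev v (f v) = (2 * d)%:R * (prop_col R k f - pair_prop k P).
Proof.
rewrite sumrB sum_sides prop_col_mean card_complete_bipartite.
rewrite pair_prop_sides // natrM.
by field; rewrite pnatr_eq0 -lt0n.
Qed.

Let dev_le1 v h : `|dev v h| <= 1.
Proof.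
have := side_prop_le1 k v.1 P_gt0; have := side_prop_ge0 k P v.1.
rewrite /dev ler_norml; case: (h == k) => /= *; apply/andP; split; lra.
Qed.

(** The box measure has total mass [pair_weight P ^+ d], see [sum_box_weight];
    its mean proportion of colour [k] does not depend on [d]. *)
Lemma box_first_moment :
  \sum_f box_weight P f * (prop_col R k f - pair_prop k P) = 0.
Proof.
have nz : (2 * d)%:R != 0 :> R by rewrite pnatr_eq0 muln_eq0 /= -lt0n.
apply: (mulfI nz); rewrite mulr0 mulr_sumr.
rewrite -[RHS](first_moment_centred dev_centred).
by apply: eq_bigr => f _; rewrite sum_dev mulrCA.
Qed.

Lemma box_second_moment :
  \sum_f box_weight P f * (prop_col R k f - pair_prop k P) ^+ 2
  <= (2 * d)%:R^-1 * pair_weight P ^+ d.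
Proof.
have pos : 0 < (2 * d)%:R :> R by rewrite ltr0n muln_gt0.
have mu_ge0 (v : K) h : 0 <= lam h * (h \in side P v.1)%:R.
  by rewrite mulr_ge0 ?ler0n // ltW.
have := second_moment_centred dev_centred mu_ge0 dev_le1.
rewrite prod_side_weight card_complete_bipartite => bound.
rewrite mulrC ler_pdivlMr // -(ler_pM2l pos) mulrC -mulrA -expr2.
apply: le_trans bound; rewrite mulr_suml ler_sum // => f _.
by rewrite sum_dev exprMn -mulrA [X in box_weight _ _ * X]mulrC.
Qed.

End Moments.
End FixedDegree.
End CompleteBipartite.

(** * Domination by the maximal pairs *)

Section DominantPairs.
Variables (R : realFieldType) (H : graph) (lam : H -> R).
Hypothesis H_edge : exists i j : H, edge i j.
Hypothesis lam_gt0 : forall i : H, 0 < lam i.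
Implicit Types P Q : {set H} * {set H}.

Local Notation eta := (Defs.eta lam).
Local Notation maxpairs := (maxpairs lam).
Local Notation pair_weight := (pair_weight lam).

Lemma complete_exists : exists2 P : {set H} * {set H},
  complete_to P.1 P.2 & 0 < pair_weight P.
Proof.
have [i [j ij]] := H_edge; exists ([set i], [set j]).
  by apply/forall_inP => u /set1P->; apply/forall_inP => v /set1P->.
by rewrite /pair_weight /wset !big_set1 mulr_gt0.
Qed.

Lemma maxpairs_exists : exists P, P \in maxpairs.
Proof.
have [P0 P0_complete _] := complete_exists.
have: eta \in [seq pair_weight P
    | P in [set P : {set H} * {set H} | complete_to P.1 P.2]].
  apply: seq_max_mem; rewrite -size_eq0 size_image -lt0n.
  by apply/card_gt0P; exists P0; rewrite inE.
case/mapP => P; rewrite mem_enum inE => cP etaE.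
by exists P; rewrite inE cP etaE /=.
Qed.

Lemma pair_weight_le_eta P : complete_to P.1 P.2 -> pair_weight P <= eta.
Proof.
move=> P_complete; apply: le_seq_max; apply/mapP.
by exists P; rewrite ?mem_enum ?inE.
Qed.

Lemma eta_gt0 : 0 < eta.
Proof.
have [P P_complete P_gt0] := complete_exists.
exact: lt_le_trans P_gt0 (pair_weight_le_eta P_complete).
Qed.

Lemma maxpairs_complete P : P \in maxpairs -> complete_to P.1 P.2.
Proof. by rewrite inE => /andP[]. Qed.

Lemma pair_weight_maxpairs P : P \in maxpairs -> pair_weight P = eta.
Proof. by rewrite inE => /andP[_ /eqP]. Qed.

Lemma maxpairs_gt0 P : P \in maxpairs -> 0 < pair_weight P.
Proof. by move=> /pair_weight_maxpairs->; exact: eta_gt0. Qed.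

(** The complete pairs whose boxes are negligible as the degree grows. *)
Definition light : {set {set H} * {set H}} :=
  [set P | complete_to P.1 P.2 & P \notin maxpairs].

Lemma pair_weight_light P : P \in light -> pair_weight P < eta.
Proof.
rewrite !inE => /andP[P_complete]; rewrite P_complete /= => neq_eta.
by rewrite lt_neqAle neq_eta pair_weight_le_eta.
Qed.

Definition pair_cap P Q := (P.1 :&: Q.1, P.2 :&: Q.2)%SET.

Lemma wset_subset_eq (A B : {set H}) :
  A \subset B -> wset lam B <= wset lam A -> A = B.
Proof.
move=> sAB; apply: contraTeq => neqAB; rewrite -ltNge.
have /properP[_ [x xB xA]] : A \proper B by rewrite properEneq neqAB.
rewrite /wset [ltRHS](big_setID A) /= (setIidPr sAB) ltrDl.
rewrite (bigD1 x) ?inE ?xA //= ltr_wpDr // sumr_ge0 // => i _.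
exact: ltW.
Qed.

(** Shrinking a side strictly loses weight because the weights are positive, so
    an intersection that is still maximal has lost nothing. *)
Lemma maxpair_cap_sub P Q :
  P \in maxpairs -> pair_cap P Q \in maxpairs -> pair_cap P Q = P.
Proof.
case: P => A B P_max cap_max.
have P_gt0 := maxpairs_gt0 P_max; have cap_gt0 := maxpairs_gt0 cap_max.
have wA := wset_side_gt0 lam_gt0 false P_gt0.
have wB := wset_side_gt0 lam_gt0 true P_gt0.
have wA' := wset_side_gt0 lam_gt0 false cap_gt0.
have wB' := wset_side_gt0 lam_gt0 true cap_gt0.
have := pair_weight_maxpairs P_max; rewrite -(pair_weight_maxpairs cap_max).
rewrite /pair_weight /pair_cap /= in wA wB wA' wB' * => weq.
have sA := subsetIl A Q.1; have sB := subsetIl B Q.2.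
have wle (C D : {set H}) : C \subset D -> wset lam C <= wset lam D.
  move=> sCD; rewrite /wset [leRHS](big_setID C) /= (setIidPr sCD) lerDl.
  by apply: sumr_ge0 => i _; exact: ltW.
congr (_, _); apply: wset_subset_eq => //.
- rewrite -(ler_pM2r wB) weq ler_wpM2l ?wle // ltW //.
- by rewrite -(ler_pM2l wA) weq ler_wpM2r ?wle // ltW.
Qed.

Lemma pair_cap_complete P Q :
  complete_to P.1 P.2 -> complete_to (pair_cap P Q).1 (pair_cap P Q).2.
Proof.
move=> /forall_inP P_complete; apply/forall_inP => u /setIP[uP _].
apply/forall_inP => v /setIP[vP _].
by have /forall_inP := P_complete u uP; apply.
Qed.

Lemma pair_capC P Q : pair_cap P Q = pair_cap Q P.
Proof. by rewrite /pair_cap setIC [in X in (_, X)]setIC. Qed.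

Definition npairs : R := #|{: {set H} * {set H}}|%:R.

Lemma npairs_ge0 : 0 <= npairs.
Proof. exact: ler0n. Qed.

Lemma npairs_ge1 : 1 <= npairs.
Proof.
by rewrite ler1n; apply/card_gt0P; exists (set0, set0).
Qed.

Lemma sum_indicator_le_npairs (A : {set {set H} * {set H}})
    (b : pred ({set H} * {set H})) :
  0 <= \sum_(P in A) ((b P)%:R : R) <= npairs.
Proof.
apply/andP; split; first by apply: sumr_ge0 => P _; exact: ler0n.
apply: (@le_trans _ _ (\sum_(P in A) 1)).
  by apply: ler_sum => P _; case: (b P).
by rewrite sumr_const ler_nat max_card.
Qed.

Section FixedDegree.
Variable d : nat.
Local Notation K := (complete_bipartite d).
Implicit Type f : {ffun K -> H}.

Lemma within_cap P Q f : within P f -> within Q f -> within (pair_cap P Q) f.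
Proof.
move=> /forallP fP /forallP fQ; apply/forallP => v.
by have := fP v; have := fQ v; case: v => -[] i /=; rewrite inE => -> ->.
Qed.

Lemma hom_within f : reflect
  (exists2 P : {set H} * {set H}, complete_to P.1 P.2 & within P f)
  (f \in Hcolourings H K).
Proof.
apply: (iffP idP) => [|[P /forall_inP P_complete /forallP f_in]].
- rewrite inE => /forallP f_hom.
  exists ([set f v | v in [pred v : K | ~~ v.1]],
          [set f v | v in [pred v : K | v.1]])%SET.
    apply/forall_inP => _ /imsetP[u /= u1 ->].
    apply/forall_inP => _ /imsetP[v /= v1 ->].
    have /forallP/(_ v)/implyP := f_hom u; apply.
    by rewrite /edge /=; move: u1 v1; rewrite !inE; case: (u.1); case: (v.1).
  by apply/forallP => -[[] i]; apply/imsetP;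
    [exists (true, i)|exists (false, i)].
- rewrite inE; apply/forallP => u; apply/forallP => v; apply/implyP.
  have := f_in u; have := f_in v; case: u v => [[] i] [[] j] //= fv fu _.
    by rewrite edge_sym; have /forall_inP := P_complete _ fv; apply.
  by have /forall_inP := P_complete _ fu; apply.
Qed.

(** A colouring in no light box lies in exactly one maximal box: it lies in some
    box, which must be maximal, and two different maximal boxes meet in a light
    one.  A colouring in a light box lies in at most [npairs] maximal boxes, and
    is counted with that multiplicity. *)
Lemma hom_weight_approx f :
  `|hom_weight lam f - \sum_(P in maxpairs) box_weight lam P f|
  <= npairs * \sum_(Q in light) box_weight lam Q f.
Proof.
under eq_bigr => P _ do rewrite box_weight_within //.
under [in leRHS]eq_bigr => Q _ do rewrite box_weight_within //.
rewrite -!mulr_sumr /hom_weight -mulrBr normrM gtr0_norm ?weight_gt0 //.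
rewrite mulrCA ler_pM2l ?weight_gt0 //.
have [/exists_inP[Q Q_light fQ]|/exists_inPn no_light] :=
    boolP [exists Q in light, within Q f].
  have -> : f \in Hcolourings H K.
    by apply/hom_within; exists Q => //; move: Q_light; rewrite inE => /andP[].
  have Q_ge1 : 1 <= \sum_(Q in light) (within Q f)%:R :> R.
    by rewrite (bigD1 Q) //= fQ lerDl sumr_ge0 // => *; exact: ler0n.
  have /andP[m_ge0 m_le] :=
    sum_indicator_le_npairs maxpairs (fun P => within P f).
  apply: (@le_trans _ _ npairs); last first.
    by rewrite ler_peMr // npairs_ge0.
  have := npairs_ge1; rewrite ler_norml /= => *; apply/andP; split; lra.
rewrite [leRHS](_ : _ = 0); last first.
  by rewrite big1 ?mulr0 // => Q /no_light/negPf->.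
rewrite normr_le0 subr_eq0; apply/eqP.
have [/hom_within[P P_complete fP]|not_hom] := boolP (f \in _); last first.
  rewrite big1 // => P P_max; case: (boolP (within P f)) => // fP.
  case/negP: not_hom; apply/hom_within; exists P => //.
  exact: maxpairs_complete.
have max_of Q : complete_to Q.1 Q.2 -> within Q f -> Q \in maxpairs.
  move=> Q_complete fQ; apply: contraLR fQ => Q_notmax.
  by apply: no_light; rewrite inE Q_complete.
rewrite (bigD1 P) ?max_of //= fP big1 ?addr0 // => Q /andP[Q_max neq_QP].
have [fQ|//] := boolP (within Q f).
have cap_max : pair_cap P Q \in maxpairs.
  by apply: max_of; [exact: pair_cap_complete|exact: within_cap].
case/eqP: neq_QP; rewrite -(maxpair_cap_sub (max_of _ P_complete fP) cap_max).
by rewrite pair_capC maxpair_cap_sub // pair_capC.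
Qed.

Lemma box_weight_le_hom_weight P f :
  complete_to P.1 P.2 -> box_weight lam P f <= hom_weight lam f.
Proof.
move=> P_complete; rewrite box_weight_within //.
apply: ler_wpM2l; first by rewrite ltW ?weight_gt0.
have [fP|_] := boolP (within P f); last exact: ler0n.
by rewrite (_ : f \in _) //; apply/hom_within; exists P.
Qed.

(** A single maximal box already has weight [eta ^+ d]; together with [Zsum_le]
    this pins down the partition function up to the factor [npairs]. *)
Lemma Zsum_ge : eta ^+ d <= Zsum lam K.
Proof.
have [P P_max] := maxpairs_exists.
rewrite -(pair_weight_maxpairs P_max) -sum_box_weight Zsum_hom_weight.
by apply: ler_sum => f _; rewrite box_weight_le_hom_weight ?maxpairs_complete.
Qed.

Lemma Zsum_gt0 : 0 < Zsum lam K.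
Proof. by apply: lt_le_trans Zsum_ge; rewrite exprn_gt0 ?eta_gt0. Qed.

Lemma Zsum_le : Zsum lam K <= npairs * eta ^+ d.
Proof.
rewrite Zsum_hom_weight.
pose total : R := \sum_(P : {set H} * {set H} | complete_to P.1 P.2)
  \sum_(f : {ffun K -> H}) box_weight lam P f.
apply: (@le_trans _ _ total).
  rewrite /total exchange_big /=; apply: ler_sum => f _; rewrite /hom_weight.
  have nonneg P : 0 <= box_weight lam P f by exact: box_weight_ge0.
  have [/hom_within[P P_complete fP]|_] := boolP (f \in _); last first.
    by rewrite mulr0 sumr_ge0.
  by rewrite (bigD1 P) //= box_weight_within // fP lerDl sumr_ge0.
have etad_ge0 : 0 <= eta ^+ d by rewrite exprn_ge0 // ltW // eta_gt0.
have total_le : total <=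
    \sum_(P : {set H} * {set H} | complete_to P.1 P.2) eta ^+ d.
  apply: ler_sum => P P_complete; rewrite sum_box_weight.
  rewrite lerXn2r ?nnegrE ?pair_weight_ge0 ?pair_weight_le_eta //.
  exact: ltW eta_gt0.
apply: (le_trans total_le).
by rewrite sumr_const -mulr_natl ler_wpM2r // ler_nat max_card.
Qed.

(** The weight of the light boxes relative to that of one maximal box. *)
Definition light_ratio : R := \sum_(Q in light) (pair_weight Q / eta) ^+ d.

Lemma light_ratio_ge0 : 0 <= light_ratio.
Proof.
apply: sumr_ge0 => Q _; rewrite exprn_ge0 // divr_ge0 ?pair_weight_ge0 //.
exact: ltW eta_gt0.
Qed.

(** All maximal boxes have the same mass, whence the uniform average. *)
Definition mean_prop k : R :=
  (\sum_(P in maxpairs) pair_prop lam k P) / #|maxpairs|%:R.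

Lemma card_maxpairs_gt0 : 0 < #|maxpairs|%:R :> R.
Proof.
have [P P_max] := maxpairs_exists.
by rewrite ltr0n; apply/card_gt0P; exists P.
Qed.

Lemma mean_prop_le k (u : R) :
  (forall P, P \in maxpairs -> pair_prop lam k P <= u) -> mean_prop k <= u.
Proof.
move=> le_u; rewrite ler_pdivrMr ?card_maxpairs_gt0 // mulr_natr -sumr_const.
exact: ler_sum.
Qed.

Lemma mean_prop_ge k (l : R) :
  (forall P, P \in maxpairs -> l <= pair_prop lam k P) -> l <= mean_prop k.
Proof.
move=> ge_l; rewrite ler_pdivlMr ?card_maxpairs_gt0 // mulr_natr -sumr_const.
exact: ler_sum.
Qed.

Lemma mean_prop_itv k : 0 <= mean_prop k <= 1.
Proof.
apply/andP; split; [apply: mean_prop_ge|apply: mean_prop_le] => P P_max;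
  by have /andP[] := pair_prop_itv lam_gt0 k (maxpairs_gt0 P_max).
Qed.

(** Replacing the colouring measure by the sum of the maximal box measures,
    for which the mean is [mean_prop k] exactly, costs only the light boxes. *)
Lemma pbar_complete_bipartite k : (0 < d)%N ->
  `|pbar lam K k - mean_prop k| <= npairs * light_ratio.
Proof.
move=> d_gt0; have Z_gt0 := Zsum_gt0.
pose X f : R := prop_col R k f - mean_prop k.
have X_le1 f : `|X f| <= 1.
  have /andP[? ?] := mean_prop_itv k.
  have := prop_col_ge0 R k f; have := prop_col_le1 R k f.
  by rewrite /X ler_norml => *; apply/andP; split; lra.
have box_cancel : \sum_f \sum_(P in maxpairs) box_weight lam P f * X f = 0.
  (* Each box is centred at its own proportion, and these average to
     mean_prop. *)
  rewrite exchange_big /=.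
  transitivity (\sum_(P in maxpairs)
      eta ^+ d * (pair_prop lam k P - mean_prop k)).
    apply: eq_bigr => P P_max; rewrite -(pair_weight_maxpairs P_max).
    have P_gt0 := maxpairs_gt0 P_max.
    rewrite -sum_box_weight mulrC -[RHS]add0r.
    rewrite -[X in _ = X + _](box_first_moment lam_gt0 k d_gt0 P_gt0).
    rewrite mulr_sumr -big_split; apply: eq_bigr => f _.
    by rewrite /X /=; ring.
  rewrite -mulr_sumr sumrB sumr_const -mulr_natr divfK ?subrr ?mulr0 //.
  by rewrite gt_eqF ?card_maxpairs_gt0.
have -> : pbar lam K k - mean_prop k =
    (\sum_f hom_weight lam f * X f) / Zsum lam K.
  rewrite pbar_hom_weight -[X in _ - X](mulfK (lt0r_neq0 Z_gt0)) -mulrBl.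
  congr (_ / _); rewrite [in X in _ - X]Zsum_hom_weight mulr_sumr -sumrB.
  by apply: eq_bigr => f _; rewrite /X; ring.
rewrite normrM normfV (gtr0_norm Z_gt0) ler_pdivrMr //.
apply: (@le_trans _ _ (npairs * light_ratio * eta ^+ d)); last first.
  by rewrite ler_wpM2l ?Zsum_ge // mulr_ge0 ?light_ratio_ge0 ?npairs_ge0.
rewrite -[X in `|X|]subr0 -[X in _ - X]box_cancel -sumrB.
apply: (le_trans (ler_norm_sum _ _ _)).
apply: (@le_trans _ _
  (\sum_(f : {ffun K -> H}) npairs * \sum_(Q in light) box_weight lam Q f)).
  apply: ler_sum => f _; rewrite -mulr_suml -mulrBl normrM.
  apply: le_trans (hom_weight_approx f).
  by rewrite ler_piMr.
rewrite -mulr_sumr exchange_big /= -mulrA ler_wpM2l ?npairs_ge0 //.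
rewrite /light_ratio mulr_suml ler_sum // => Q _.
by rewrite sum_box_weight -exprMn divfK // gt_eqF ?eta_gt0.
Qed.

(** The box of [P] has probability at least [npairs^-1], and inside it the
    proportion concentrates. *)
Lemma prob_near_pair k P g : (0 < d)%N -> P \in maxpairs ->
  0 < g -> (2 * d)%:R^-1 <= g ^+ 3 ->
  npairs^-1 - g <= prob lam (fun f : {ffun K -> H} =>
    `|prop_col R k f - pair_prop lam k P| <= g).
Proof.
move=> d_gt0 P_max g_gt0 g_large; have Z_gt0 := Zsum_gt0.
have np_gt0 : 0 < npairs by exact: lt_le_trans ltr01 npairs_ge1.
have np_le1 : npairs^-1 <= 1 by rewrite invf_le1 // npairs_ge1.
(* For g >= 1 the lower bound is nonpositive. *)
have [g_lt1|g_ge1] := ltP g 1; last first.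
  by apply: le_trans (prob_ge0 _ _); rewrite // subr_le0 (le_trans np_le1).
rewrite prob_hom_weight ler_pdivlMr //.
have etad_gt0 : 0 < eta ^+ d by rewrite exprn_gt0 ?eta_gt0.
have box_near : (1 - g) * eta ^+ d <=
    \sum_(f : {ffun K -> H} | `|prop_col R k f - pair_prop lam k P| <= g)
      box_weight lam P f.
  rewrite -(pair_weight_maxpairs P_max) -sum_box_weight.
  apply: (chebyshev_cubic (X := @prop_col R H K k)) => // [f|].
    exact: box_weight_ge0.
  rewrite sum_box_weight.
  apply: le_trans (box_second_moment lam_gt0 k d_gt0 (maxpairs_gt0 P_max)) _.
  by rewrite ler_wpM2r // exprn_ge0 // pair_weight_ge0.
apply: (@le_trans _ _ ((1 - g) * eta ^+ d)).
  apply: (@le_trans _ _ ((1 - g) * npairs^-1 * Zsum lam K)).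
    rewrite ler_wpM2r ?(ltW Z_gt0) // mulrBl mul1r lerB //.
    by rewrite ler_piMr // ltW.
  rewrite -mulrA ler_wpM2l ?subr_ge0 ?(ltW g_lt1) //.
  by rewrite ler_pdivrMl // Zsum_le.
apply: (le_trans box_near); apply: ler_sum => f _.
by rewrite box_weight_le_hom_weight // maxpairs_complete.
Qed.

End FixedDegree.

Lemma pair_value_maxpairs k P : P \in maxpairs ->
  pair_value lam k P / (2 * eta) = pair_prop lam k P.
Proof. by move=> P_max; rewrite /pair_prop pair_weight_maxpairs. Qed.

Lemma pair_values_neq0 k : [seq pair_value lam k P | P in maxpairs] != [::].
Proof.
have [P P_max] := maxpairs_exists.
by rewrite -size_eq0 size_image -lt0n; apply/card_gt0P; exists P.
Qed.

Lemma aplus_attained k :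
  exists2 P, P \in maxpairs & aplus lam k = pair_prop lam k P.
Proof.
have /mapP[P] := seq_max_mem (pair_values_neq0 k).
rewrite mem_enum => P_max maxE; exists P => //.
by rewrite /aplus maxE pair_value_maxpairs.
Qed.

Lemma aminus_attained k :
  exists2 P, P \in maxpairs & aminus lam k = pair_prop lam k P.
Proof.
have /mapP[P] := seq_min_mem (pair_values_neq0 k).
rewrite mem_enum => P_max minE; exists P => //.
by rewrite /aminus minE pair_value_maxpairs.
Qed.

Lemma mean_prop_between k : aminus lam k <= mean_prop k <= aplus lam k.
Proof.
have pos : 0 <= (2 * eta)^-1 by rewrite invr_ge0 mulr_ge0 // ltW // eta_gt0.
apply/andP; split; [apply: mean_prop_ge|apply: mean_prop_le] => P P_max;
  rewrite -pair_value_maxpairs // ler_wpM2r //;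
  [apply: seq_min_le|apply: le_seq_max];
  by apply/mapP; exists P; rewrite ?mem_enum.
Qed.

End DominantPairs.

(** * Disjoint copies *)

Section Copies.
Variables (R : realFieldType) (H : graph) (lam : H -> R).
Hypothesis lam_gt0 : forall i : H, 0 < lam i.
Variables (n : nat) (G : graph).
Local Notation Gn := (copies n G).
Implicit Types (F : {ffun 'I_n -> {ffun G -> H}}) (t : {ffun G -> H}).

(** A function on the copies is a family of functions on one copy; through this
    bijection the colouring weight becomes a product weight. *)
Definition glue (F : {ffun 'I_n -> {ffun G -> H}}) : {ffun Gn -> H} :=
  [ffun v : Gn => F v.1 v.2].

Lemma glue_bij : bijective glue.
Proof.
exists (fun f : {ffun Gn -> H} => [ffun i => [ffun v => f (i, v)]]).
  by move=> F; apply/ffunP => i; apply/ffunP => v; rewrite !ffunE.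
by move=> f; apply/ffunP => -[i v]; rewrite !ffunE.
Qed.

Lemma hom_weight_glue F :
  hom_weight lam (glue F) = \prod_i hom_weight lam (F i).
Proof.
rewrite /hom_weight big_split /=; congr (_ * _).
  rewrite /weight; transitivity (\prod_i \prod_v lam (F i v)) => //.
  by rewrite pair_bigA; apply: eq_bigr => v _; rewrite ffunE.
have [all_hom|/forallPn[i not_hom]] :=
    boolP [forall i, F i \in Hcolourings H G]; last first.
  rewrite [RHS](bigD1 i) //= (negPf not_hom) mul0r.
  rewrite (_ : glue F \in _ = false) //; apply: contraNF not_hom.
  rewrite !inE => /forallP homF; apply/forallP => u; apply/forallP => v.
  have /forallP/(_ (i, v)) := homF (i, u).
  by rewrite /edge /= eqxx !ffunE.
rewrite [RHS]big1 => [|i _]; last by rewrite (forallP all_hom).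
rewrite (_ : glue F \in _) // inE.
apply/forallP => u; apply/forallP => v; apply/implyP => /andP[/eqP uv1 uv2].
have := forallP all_hom u.1; rewrite inE => /forallP/(_ u.2)/forallP/(_ v.2).
by rewrite uv2 !ffunE uv1.
Qed.

Lemma sum_glue (X : {ffun Gn -> H} -> R) :
  \sum_f hom_weight lam f * X f =
  \sum_(F : {ffun 'I_n -> {ffun G -> H}})
    (\prod_i hom_weight lam (F i)) * X (glue F).
Proof.
rewrite (reindex glue) /=; last exact: onW_bij glue_bij.
by apply: eq_bigr => F _; rewrite hom_weight_glue.
Qed.

Lemma Zsum_copies : Zsum lam Gn = Zsum lam G ^+ n.
Proof.
rewrite Zsum_hom_weight; transitivity (\sum_f hom_weight lam (G := Gn) f * 1).
  by apply: eq_bigr => f _; rewrite mulr1.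
rewrite sum_glue -[n in RHS]card_ord -prodr_const Zsum_hom_weight.
rewrite bigA_distr_bigA.
by apply: eq_bigr => F _; rewrite mulr1.
Qed.

Lemma prop_col_glue k F :
  prop_col R k (glue F) = (\sum_i prop_col R k (F i)) / n%:R.
Proof.
rewrite prop_col_mean card_copies mulnC natrM invfM mulrA; congr (_ / _).
under [RHS]eq_bigr => i _ do rewrite prop_col_mean.
rewrite -mulr_suml pair_bigA; congr (_ / _).
by apply: eq_bigr => v _; rewrite ffunE.
Qed.

Hypothesis n_gt0 : (0 < n)%N.
Hypothesis Z_gt0 : 0 < Zsum lam G.

Let n_neq0 : n%:R != 0 :> R.
Proof. by rewrite pnatr_eq0 -lt0n. Qed.

Let dev k (i : 'I_n) t : R := prop_col R k t - pbar lam G k.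

Let dev_centred k i : \sum_t hom_weight lam t * dev k i t = 0.
Proof.
under eq_bigr => t _ do rewrite mulrBr.
rewrite sumrB -mulr_suml -Zsum_hom_weight pbar_hom_weight.
by rewrite [X in _ - X]mulrC divfK ?subrr // gt_eqF.
Qed.

Let sum_dev k F :
  \sum_i dev k i (F i) = n%:R * (prop_col R k (glue F) - pbar lam G k).
Proof.
rewrite sumrB sumr_const card_ord prop_col_glue mulrBr.
by rewrite [_ * (_ / _)]mulrC divfK // mulr_natl.
Qed.

Let dev_le1 k i t : `|dev k i t| <= 1.
Proof.
have /andP[? ?] := pbar_itv lam_gt0 k Z_gt0.
have := prop_col_ge0 R k t; have := prop_col_le1 R k t.
by rewrite /dev ler_norml => *; apply/andP; split; lra.
Qed.

Lemma pbar_copies k : pbar lam Gn k = pbar lam G k.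
Proof.
have Zn_neq0 : Zsum lam Gn != 0.
  by rewrite Zsum_copies expf_neq0 // gt_eqF.
apply/eqP; rewrite -subr_eq0; apply/eqP.
rewrite pbar_hom_weight -[X in _ - X](mulfK Zn_neq0) -mulrBl.
rewrite [in X in _ - X]Zsum_hom_weight mulr_sumr -sumrB.
rewrite (eq_bigr (fun f : {ffun Gn -> H} =>
  hom_weight lam f * (prop_col R k f - pbar lam G k))); last first.
  by move=> f _; ring.
rewrite sum_glue.
have := first_moment_centred (dev_centred k).
under eq_bigr => F _ do rewrite sum_dev mulrCA.
rewrite -mulr_sumr => /eqP; rewrite mulf_eq0 (negPf n_neq0) /= => /eqP->.
by rewrite mul0r.
Qed.

Lemma copies_variance k :
  \sum_(f : {ffun Gn -> H})
    hom_weight lam f * (prop_col R k f - pbar lam G k) ^+ 2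
  <= n%:R^-1 * Zsum lam Gn.
Proof.
have n_pos : 0 < n%:R :> R by rewrite ltr0n.
have := second_moment_centred (dev_centred k)
  (fun i t => hom_weight_ge0 lam_gt0 t) (dev_le1 k).
rewrite -Zsum_hom_weight prodr_const card_ord -Zsum_copies => bound.
rewrite sum_glue mulrC ler_pdivlMr // -(ler_pM2l n_pos) mulrC -mulrA -expr2.
apply: le_trans bound; rewrite mulr_suml ler_sum // => F _.
by rewrite sum_dev exprMn -mulrA [X in _ * X <= _]mulrC.
Qed.

(** With independent copies the proportion concentrates at its mean, and the
    bias of the mean adds to the deviation. *)
Lemma prob_near_copies k (a g delta : R) : 0 < g ->
  `|pbar lam G k - a| <= delta ->
  2 * n%:R^-1 + 2 * delta ^+ 2 <= g ^+ 3 ->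
  1 - g <= prob lam (fun f : {ffun Gn -> H} => `|prop_col R k f - a| <= g).
Proof.
move=> g_gt0 bias g_large.
have Zn_gt0 : 0 < Zsum lam Gn by rewrite Zsum_copies exprn_gt0.
rewrite prob_hom_weight ler_pdivlMr // Zsum_hom_weight.
apply: (chebyshev_cubic (X := @prop_col R H Gn k)) => // [f|].
  exact: hom_weight_ge0.
rewrite -Zsum_hom_weight.
apply: le_trans (ler_wpM2r (ltW Zn_gt0) g_large).
apply: (@le_trans _ _ (\sum_(f : {ffun Gn -> H})
   (2 * (hom_weight lam f * (prop_col R k f - pbar lam G k) ^+ 2) +
    2 * delta ^+ 2 * hom_weight lam f))).
  apply: ler_sum => f _; set x := prop_col R k f; set m := pbar lam G k.
  have bias2 : (m - a) ^+ 2 <= delta ^+ 2.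
    rewrite -real_normK ?num_real // lerXn2r ?nnegrE //.
    exact: le_trans bias.
  rewrite [leRHS](_ : _ =
    hom_weight lam f * (2 * (x - m) ^+ 2 + 2 * delta ^+ 2)); last by ring.
  rewrite ler_wpM2l ?hom_weight_ge0 //.
  (* Here (x - a)^2 <= 2 (x - m)^2 + 2 (m - a)^2; the difference of the two
     sides is the square of (x - m) - (m - a). *)
  have := sqr_ge0 (x - 2 * m + a); rewrite !expr2 in bias2 *; nra.
rewrite big_split /= -!mulr_sumr -(Zsum_hom_weight lam Gn) [leRHS]mulrDl.
by rewrite lerD2r -[leRHS]mulrA ler_pM2l ?copies_variance.
Qed.

End Copies.

(** * Passage to the limit *)

Local Open Scope classical_set_scope.
Local Open Scope ring_scope.

Section Tolerance.
Variable R : realType.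

(** A modulus that dominates [eps], has a cube dominating [eps], and still
    vanishes with [eps]: the fourth root handles small values and the summand
    [eps] the large ones. *)
Definition tolerance (eps : R) : R := Num.sqrt (Num.sqrt eps) + eps.

Lemma tolerance_ge eps : eps <= tolerance eps.
Proof. by rewrite lerDr sqrtr_ge0. Qed.

Lemma tolerance_cube eps : 0 <= eps -> eps <= tolerance eps ^+ 3.
Proof.
move=> eps_ge0; rewrite /tolerance; set r := Num.sqrt (Num.sqrt eps).
have r_ge0 : 0 <= r by exact: sqrtr_ge0.
have epsE : eps = r ^+ 4.
  by rewrite (exprM r 2 2) sqr_sqrtr ?sqrtr_ge0 // sqr_sqrtr.
have r_le : r <= 1 + r ^+ 3.
  have [r_le1|r_gt1] := leP r 1; first by rewrite ler_wpDr ?exprn_ge0.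
  by rewrite ler_wpDl // -[leLHS]expr1 ler_weXn2l // ltW.
have -> : (r + eps) ^+ 3 = r ^+ 3 * (1 + r ^+ 3) ^+ 3 by rewrite epsE; ring.
rewrite {1}epsE exprSr ler_wpM2l ?exprn_ge0 //; apply: (le_trans r_le).
have := exprn_ge0 3 r_ge0; set t := r ^+ 3 => t_ge0.
by rewrite -[leLHS]expr1 ler_weXn2l // lerDl.
Qed.

Lemma cvg_tolerance (u : nat -> R) :
  u n @[n --> \oo] --> (0 : R) -> tolerance (u n) @[n --> \oo] --> (0 : R).
Proof.
move=> u_cvg; rewrite -[X in _ --> X]addr0 /tolerance.
apply: cvgD => //.
have sqrt_cvg (v : nat -> R) : v n @[n --> \oo] --> (0 : R) ->
    Num.sqrt (v n) @[n --> \oo] --> (0 : R).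
  by move=> v_cvg; rewrite -[X in _ --> X]sqrtr0; apply: continuous_cvg => //;
    exact: sqrt_continuous.
exact: sqrt_cvg (sqrt_cvg _ u_cvg).
Qed.

Lemma cvg_light_ratio (H : graph) (lam : H -> R) :
  (exists i j : H, edge i j) -> (forall i, 0 < lam i) ->
  light_ratio lam d @[d --> \oo] --> (0 : R).
Proof.
move=> H_edge lam_gt0; rewrite /light_ratio.
rewrite [X in _ --> X](_ : 0 = \sum_(Q in light lam) 0); last by rewrite big1.
apply: cvg_big => [|Q Q_light]; first exact: add_continuous.
apply: cvg_expr.
have eta_pos := eta_gt0 H_edge lam_gt0.
rewrite ger0_norm; last by rewrite divr_ge0 ?pair_weight_ge0 // ltW.
by rewrite ltr_pdivrMr // mul1r pair_weight_light.
Qed.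

End Tolerance.

Theorem theorem1p4 (R : realType) (H : graph) (lam : H -> R)
  (H_edge : exists i j : H, edge i j)
  (lam_gt0 : forall i : H, 0 < lam i) :
  (exists (G : nat -> graph) (g : nat -> R) (c : R),
    [/\ forall d, (0 < d)%N -> regular_bipartite d (G d),
        g n @[n --> \oo] --> (0 : R),
        0 < c
      & forall d, (0 < d)%N -> forall k : H,
          prob lam (fun f : {ffun G d -> H} =>
                      `|prop_col R k f - aplus lam k| <= g d) >= c - g d /\
          prob lam (fun f : {ffun G d -> H} =>
                      `|prop_col R k f - aminus lam k| <= g d) >= c - g d])
  /\
  (exists (G' : nat -> graph) (g : nat -> R) (a : H -> R),
    [/\ forall d, (0 < d)%N -> regular_bipartite d (G' d),
        g n @[n --> \oo] --> (0 : R),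
        forall k : H, aminus lam k <= a k <= aplus lam k
      & forall d, (0 < d)%N -> forall k : H,
          prob lam (fun f : {ffun G' d -> H} =>
                      `|prop_col R k f - a k| <= g d) >= 1 - g d /\
          `|pbar lam (G' d) k - a k| <= g d]).
Proof.
pose delta d : R := npairs R H * light_ratio lam d.
have delta_ge0 d : 0 <= delta d.
  by rewrite mulr_ge0 ?npairs_ge0 ?light_ratio_ge0.
(* Collects the variance over d + 1 copies, the squared bias of the mean and
   the bias itself; it also exceeds the variance bound 1 / (2 d) in a box. *)
pose eps d : R := 2 * harmonic d + 2 * delta d ^+ 2 + delta d.
pose g d := tolerance (eps d).
have inv_gt0 d : 0 < harmonic d :> R by exact: harmonic_gt0.
have eps_gt0 d : 0 < eps d.
  have := inv_gt0 d; have := delta_ge0 d; have := sqr_ge0 (delta d).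
  by rewrite /eps; lra.
have g_gt0 d : 0 < g d by exact: lt_le_trans (tolerance_ge _).
have g_cube d : eps d <= g d ^+ 3 by apply: tolerance_cube; exact: ltW.
have delta_cvg : delta d @[d --> \oo] --> (0 : R).
  rewrite -[X in _ --> X](mulr0 (npairs R H)).
  by apply: cvgMr; exact: cvg_light_ratio.
have g_cvg : g d @[d --> \oo] --> (0 : R).
  apply: cvg_tolerance; rewrite /eps.
  rewrite -[X in _ --> X](_ : 2 * 0 + 2 * (0 * 0) + 0 = 0 :> R); last by ring.
  apply: cvgD => //; apply: cvgD; apply: cvgMr.
    exact: cvg_harmonic.
  under eq_fun do rewrite expr2.
  exact: cvgM.
split.
- exists complete_bipartite, g, (npairs R H)^-1.
  split=> // [d d_gt0||d d_gt0 k].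
  + exact: complete_bipartite_regular.
  + by rewrite invr_gt0 (lt_le_trans ltr01) ?npairs_ge1.
  have g_large : (2 * d)%:R^-1 <= g d ^+ 3.
    apply: le_trans (g_cube d).
    apply: (@le_trans _ _ (harmonic d)).
      rewrite lef_pV2 ?posrE ?ltr0n ?muln_gt0 // ler_nat.
      by rewrite mul2n -addnn -addn1 leq_add2l.
    have := inv_gt0 d; have := delta_ge0 d; have := sqr_ge0 (delta d).
    by rewrite /eps; lra.
  have [Pmax Pmax_in ->] := aplus_attained H_edge lam_gt0 k.
  have [Pmin Pmin_in ->] := aminus_attained H_edge lam_gt0 k.
  by split; exact: prob_near_pair.
- exists (fun d => copies d.+1 (complete_bipartite d)), g, (mean_prop lam).
  split=> // [d d_gt0|k|d d_gt0 k].
  + by apply: copies_regular => //; exact: complete_bipartite_regular.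
  + exact: mean_prop_between.
  have Z_gt0 := Zsum_gt0 H_edge lam_gt0 d.
  have bias := pbar_complete_bipartite H_edge lam_gt0 k d_gt0.
  split; last first.
    rewrite pbar_copies //; apply: (le_trans bias).
    apply: le_trans (tolerance_ge _).
    have := inv_gt0 d; have := sqr_ge0 (delta d).
    by rewrite /eps -/(delta d); lra.
  apply: (prob_near_copies lam_gt0 _ Z_gt0 (g_gt0 d) bias) => //.
  by apply: le_trans (g_cube d); rewrite ler_wpDr ?delta_ge0.
Qed.
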